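(* Let $q$ be a prime power. For $3\le n<6$, the number of generic $q^n$-points of $\mathbb{P}^2(\overline{\mathbb{F}}_q)$ is \[\bigl|\mathbb{P}^2(\overline{\mathbb{F}}_q^{(n,\,\mathrm{gen})})\bigr|=\bigl|\mathbb{P}^2(\overline{\mathbb{F}}_q^{(n)})\bigr|-\bigl|\mathbb{P}^2(\mathbb{F}_q)^\vee\bigr|\cdot\bigl|\mathbb{P}^1(\overline{\mathbb{F}}_q^{(n)})\bigr|.\] For $n=6$, \[\bigl|\mathbb{P}^2(\overline{\mathbb{F}}_q^{(6,\,\mathrm{gen})})\bigr|=\bigl|\mathbb{P}^2(\overline{\mathbb{F}}_q^{(6)})\bigr|-\bigl|\mathbb{P}^2(\mathbb{F}_q)^\vee\bigr|\cdot\bigl|\mathbb{P}^1(\overline{\mathbb{F}}_q^{(6)})\bigr|-\bigl|\mathbb{P}^2(\overline{\mathbb{F}}_q^{(2)})^\vee\bigr|\cdot\bigl|\mathbb{P}^1(\overline{\mathbb{F}}_{q^2}^{(3)})\bigr|.\]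
   Context: Let $f=\mathrm{Frob}_q$ act on $\mathbb{P}^N(\overline{\mathbb{F}}_q)$ by raising coordinates to the $q$th power. A point whose $f$-orbit has exactly $n$ elements is a $q^n$-point; $\mathbb{P}^N(\overline{\mathbb{F}}_q^{(n)})$ denotes the set of $q^n$-points of $\mathbb{P}^N(\overline{\mathbb{F}}_q)$. Applying this with $q^2$ in place of $q$, $\mathbb{P}^1(\overline{\mathbb{F}}_{q^2}^{(3)})$ is the set of points of $\mathbb{P}^1(\overline{\mathbb{F}}_q)$ whose $\mathrm{Frob}_{q^2}$-orbit has exactly $3$ elements. A line $\ell\subset\mathbb{P}^2(\overline{\mathbb{F}}_q)$ whose $f$-orbit has exactly $n$ elements is a $q^n$-line. $\mathbb{P}^2(\mathbb{F}_q)^\vee$ is the set of $q$-lines ($=q^1$-lines) and $\mathbb{P}^2(\overline{\mathbb{F}}_q^{(2)})^\vee$ is the set of $q^2$-lines in $\mathbb{P}^2(\overline{\mathbb{F}}_q)$. A $q^n$-point $p\in\mathbb{P}^2(\overline{\mathbb{F}}_q)$ is generic if it does not lie on any $q^r$-line for $r<n$ when $n$ is odd, respectively for $r<n/2$ when $n$ is even. $\mathbb{P}^2(\overline{\mathbb{F}}_q^{(n,\,\mathrm{gen})})$ is the set of generic $q^n$-points. *)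

(* Defs.v *)
From HB Require Import structures.
From mathcomp Require Export all_boot all_order all_algebra generic_quotient.
From mathcomp Require Export finmap.
From mathcomp Require Export boolp classical_sets functions cardinality.

Set Implicit Arguments.
Unset Strict Implicit.
Unset Printing Implicit Defensive.

Import GRing.Theory.
Local Open Scope classical_set_scope.
Local Open Scope ring_scope.
Local Open Scope quotient_scope.
Local Open Scope card_scope.

Section ProjectiveSpace.
Variables (K : fieldType) (N : nat).

Definition nzvec := {x : 'rV[K]_N.+1 | x != 0}.

Definition proportional (x y : nzvec) : bool :=
  `[< exists2 c : K, c != 0 & val y = c *: val x >].

Lemma proportional_refl : reflexive proportional.
Proof. by move=> x; apply/asboolP; exists 1; rewrite ?oner_neq0 ?scale1r. Qed.

Lemma proportional_sym : symmetric proportional.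
Proof.
have imp x y : proportional x y -> proportional y x.
  move=> /asboolP[c c0 e]; apply/asboolP.
  by exists c^-1; rewrite ?invr_eq0// e scalerA mulVf// scale1r.
by move=> x y; apply/idP/idP; exact: imp.
Qed.

Lemma proportional_trans : transitive proportional.
Proof.
move=> y x z /asboolP[c c0 e] /asboolP[d d0 e']; apply/asboolP.
by exists (d * c); rewrite ?mulf_neq0// e' e scalerA.
Qed.

Canonical proportional_equiv :=
  EquivRel proportional proportional_refl proportional_sym proportional_trans.

Definition projsp := {eq_quot proportional}.
HB.instance Definition _ := Choice.on projsp.
HB.instance Definition _ := Quotient.on projsp.
HB.instance Definition _ := EqQuotient.on projsp.

Variable q : nat.

Lemma frob_vec_neq0 (x : nzvec) : map_mx (fun a => a ^+ q) (val x) != 0.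
Proof.
case: x => x /= x0; apply: contra x0 => /eqP e; apply/eqP/rowP => i.
by have /rowP/(_ i)/eqP := e; rewrite !mxE expf_eq0 => /andP[_ /eqP].
Qed.

Definition frob_vec (x : nzvec) : nzvec :=
  exist (fun y : 'rV[K]_N.+1 => y != 0) _ (frob_vec_neq0 x).

Definition frob (p : projsp) : projsp := \pi_projsp (frob_vec (repr p)).

Lemma frob_pi (x : nzvec) : frob (\pi_projsp x) = \pi_projsp (frob_vec x).
Proof.
apply/eqmodP; case: piP => y /eqmodP /asboolP[c c0 e]; apply/asboolP.
exists (c ^- q); first by rewrite invr_eq0 expf_neq0.
apply/rowP => i; rewrite !mxE e !mxE exprMn mulrA mulVf ?mul1r//.
by rewrite expf_neq0.
Qed.

End ProjectiveSpace.

(* For the bijective maps used below, a finite forward orbit is the whole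
   orbit. *)
Definition orbit_has_card (T : Type) (f : T -> T) (x : T) (n : nat) : Prop :=
  [set iter k f x | k in [set: nat]] #= `I_n.

Section FrobeniusOrbits.
Variables (K : fieldType) (q : nat).

Definition qpoints (N n : nat) : set (projsp K N) :=
  [set p | orbit_has_card (@frob K N q) p n].

Definition on_zeros (a : 'rV[K]_3) (p : projsp K 2) : Prop :=
  \sum_(i < 3) a 0 i * val (repr p) 0 i = 0.

Lemma on_zeros_pi (a : 'rV[K]_3) (x : nzvec K 2) :
  on_zeros a (\pi_(projsp K 2) x) <-> \sum_(i < 3) a 0 i * val x 0 i = 0.
Proof.
rewrite /on_zeros; case: piP => y /eqmodP /asboolP[c c0 ->].
have -> : \sum_(i < 3) a 0 i * (c *: val x) 0 i
          = c * \sum_(i < 3) a 0 i * val x 0 i.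
  by rewrite mulr_sumr; apply: eq_bigr => i _; rewrite mxE mulrCA.
split=> [/eqP|->]; last by rewrite mulr0.
by rewrite mulf_eq0 (negPf c0) => /eqP.
Qed.

Definition is_line (l : set (projsp K 2)) : Prop :=
  exists2 a : 'rV[K]_3, a != 0 & l = [set p | on_zeros a p].

Definition qlines (n : nat) : set (set (projsp K 2)) :=
  [set l | is_line l /\
     orbit_has_card (fun m : set (projsp K 2) => @frob K 2 q @` m) l n].

Definition generic_qpoints (n : nat) : set (projsp K 2) :=
  [set p | qpoints n p /\
     forall (r : nat) (l : set (projsp K 2)),
       (r < if odd n then n else n./2)%N -> qlines r l -> ~ l p].

End FrobeniusOrbits.

(* Every set counted in the statement is finite, so the default value 0 of
   fset_set on infinite sets plays no role. *)
Definition ncard (T : choiceType) (A : set T) : nat := #|` fset_set A|.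

(* Main.v *)
(** Two distinct points determine a line.  If a point p of Frobenius period n
    lies on a line of period r with gcd(r, n) = 1, the line contains the whole
    orbit of p, hence equals its own Frobenius image, and r = 1.  So for
    3 <= n < 6 the non-generic points are those on q-lines, while for n = 6
    they are those on q-lines or on q^2-lines.  As p differs from f(p) and, for
    n = 6, from f^2(p), these lines are unique and the two families of points
    are disjoint.  A line fixed by f has an equation with coefficients in F_q,
    hence a Frobenius-equivariant parametrisation by P^1, which counts its
    points; the same applies to q^2-lines with f^2 in place of f. *)
Require Import Defs.
From mathcomp Require Import finfield.

Set Implicit Arguments.
Unset Strict Implicit.
Unset Printing Implicit Defensive.

Import GRing.Theory.
Local Open Scope classical_set_scope.
Local Open Scope ring_scope.
Local Open Scope quotient_scope.
Local Open Scope card_scope.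

(** * Orbits and exact periods of injective maps *)

Section Orbits.
Variables (T : Type) (f : T -> T).
Hypothesis f_inj : injective f.

Lemma iter_inj k : injective (iter k f).
Proof. by elim: k => // k IHk x y /= /f_inj /IHk. Qed.

Lemma iter_eq_sub x i j : (i <= j)%N -> iter i f x = iter j f x ->
  iter (j - i) f x = x.
Proof. by move=> ij; rewrite -{1}(subnKC ij) iterD => /iter_inj. Qed.

Lemma iter_fixM x n k : iter n f x = x -> iter (k * n) f x = x.
Proof. by move=> e; elim: k => // k IHk; rewrite mulSn iterD IHk. Qed.

Lemma iter_fix_mod x n k : iter n f x = x -> iter k f x = iter (k %% n) f x.
Proof.
by move=> e; rewrite {1}(divn_eq k n) addnC iterD iter_fixM.
Qed.

(** Exponents matter only modulo [n], and two distinct residues giving the same point would yield a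
    positive period smaller than [n]. *)
Lemma exact_period_orbit x n :
  (0 < n)%N -> (forall m, iter m f x = x <-> (n %| m)%N) ->
  orbit_has_card f x n.
Proof.
move=> n0 per; rewrite /orbit_has_card.
have -> : [set iter k f x | k in [set: nat]] = (fun k => iter k f x) @` `I_n.
  apply/seteqP; split=> [_ [k _ <-]|_ [k _ <-]]; last by exists k.
  exists (k %% n)%N; first by rewrite /= ltn_mod.
  by rewrite -iter_fix_mod //; apply/per.
apply: inj_card_eq => i j; rewrite !inE /=.
wlog ij : i j / (i <= j)%N.
  by move=> H; case: (leqP i j) => [/H//|/ltnW/H{}H ? ? /esym/H->].
move=> _ jn /(iter_eq_sub ij)/per dv; apply/eqP; rewrite eqn_leq ij /=.
rewrite -subn_eq0; apply: contraLR dv; rewrite -lt0n => /gtnNdvd -> //.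
by rewrite (leq_ltn_trans (leq_subr _ _)).
Qed.

(** Trades orbit cardinality for a divisibility criterion, the form in which periods of points and
    lines are compared below. *)
Lemma orbit_has_cardP x n : orbit_has_card f x n <->
  (0 < n)%N /\ forall m, iter m f x = x <-> (n %| m)%N.
Proof.
split=> [orb|[n0 per]]; last exact: exact_period_orbit.
have [m /andP[m0 /asboolP mx]] :
    exists m, (0 < m)%N && `[< iter m f x = x >].
  (* Without a positive period all iterates would be distinct, and the naturals would embed into a
     finite orbit. *)
  apply: contrapT => noper; apply: infinite_nat.
  have fin : finite_set [set iter k f x | k in [set: nat]] by exists n.
  rewrite -(eq_finite_set (@inj_card_eq _ _ setT (fun k => iter k f x) _)) //.
  move=> i j _ _.
  wlog ij : i j / (i <= j)%N.
    by move=> H; case: (leqP i j) => [/H//|/ltnW/H{}H /esym/H->].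
  move=> /(iter_eq_sub ij) e; apply/eqP; rewrite eqn_leq ij /= -subn_eq0.
  apply: contrapT => /negP; rewrite -lt0n => ji; apply: noper.
  by exists (j - i)%N; rewrite ji; apply/asboolP.
have ex : exists m, (0 < m)%N && `[< iter m f x = x >].
  by exists m; rewrite m0; apply/asboolP.
case: (ex_minnP ex) => d /andP[d0 /asboolP dx] dmin.
have per k : iter k f x = x <-> (d %| k)%N.
  split=> [kx|/dvdnP[c ->]]; last exact: iter_fixM.
  rewrite /dvdn -leqn0 leqNgt; apply/negP => r0.
  have := dmin (k %% d)%N; rewrite r0 leqNgt ltn_mod d0 /=.
  by move/(_ _)/negP; apply=> //; apply/asboolP; rewrite -iter_fix_mod.
(* The orbit has [n] elements by assumption and [d] elements by minimality of the period [d]. *)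
have dn : d = n.
  apply/card_eq_II; rewrite card_eq_sym.
  by rewrite -(card_eql orb) exact_period_orbit.
by rewrite -dn.
Qed.

End Orbits.

(** Makes the orbit criterion applicable to the Frobenius action on lines, which are sets of
    points. *)
Lemma image_injective (T U : Type) (f : T -> U) :
  injective f -> injective (fun A : set T => f @` A).
Proof.
move=> f_inj A B AB; apply/seteqP; split=> x Ax.
  by rewrite -(image_inj f_inj) -AB; exists x.
by rewrite -(image_inj f_inj) AB; exists x.
Qed.

Lemma iter_image (T : Type) (f : T -> T) k (A : set T) :
  iter k (fun B : set T => f @` B) A = iter k f @` A.
Proof.
elim: k => [|k IHk]; first by rewrite image_id.
by rewrite iterS IHk image_comp.
Qed.

(** * Cardinalities of finite sets and double counting *)

Section Counting.
Variables T U : choiceType.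

Lemma ncard_image (f : T -> U) (A : set T) :
  finite_set A -> {in A &, injective f} -> ncard (f @` A) = ncard A.
Proof.
move=> finA f_inj; apply/fcard_eq => //; first exact: finite_image.
exact: inj_card_eq.
Qed.

Lemma ncardU (A B : set T) : finite_set A -> finite_set B -> A `&` B = set0 ->
  ncard (A `|` B) = (ncard A + ncard B)%N.
Proof.
move=> finA finB AB0; rewrite /ncard fset_setU // cardfsU -fset_setI //.
by rewrite AB0 fset_set0 cardfs0 subn0.
Qed.

Lemma ncard_setI_sum (A B : set T) : finite_set A ->
  ncard (A `&` B) = (\sum_(x <- fset_set A) `[< B x >])%N.
Proof.
move=> finA; have -> : (\sum_(x <- fset_set A) `[< B x >])%N
    = size [seq x <- fset_set A | `[< B x >]].
  rewrite size_filter -sum1_count [RHS]big_mkcond.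
  by apply: eq_bigr => x _; case: asbool.
apply/perm_size/uniq_perm; rewrite ?filter_uniq //.
have finAB : finite_set (A `&` B) by apply: sub_finite_set finA => x [].
by move=> x; rewrite mem_filter !in_fset_set // in_setI andbC; congr andb.
Qed.

(** Incident pairs are summed in both orders: each point counted lies on exactly one member of [S],
    and each member carries [m] points of [A]. *)
Lemma ncard_double_count (A : set T) (S : set U) (inc : U -> set T) m :
    finite_set A -> finite_set S ->
    (forall l, S l -> ncard (A `&` inc l) = m) ->
    (forall x l l', A x -> S l -> S l' -> inc l x -> inc l' x -> l = l') ->
  ncard [set x | A x /\ exists2 l, S l & inc l x] = (ncard S * m)%N.
Proof.
move=> finA finS card_inc uniq_inc; set X := (X in ncard X).
have finX : finite_set X by apply: sub_finite_set finA => x [].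
rewrite {1}/ncard card_fset_sum1.
transitivity (\sum_(x <- fset_set X) \sum_(l <- fset_set S) `[< inc l x >])%N.
  rewrite big_seq [RHS]big_seq; apply: eq_bigr => x.
  rewrite in_fset_set // inE => -[Ax [l Sl lx]].
  rewrite (bigD1_seq l) ?in_fset_set //=; last exact: mem_set.
  rewrite big_seq_cond big1 ?addn0.
    by have /asboolP -> := lx.
  move=> l'; rewrite in_fset_set // => /andP[/set_mem Sl' /eqP ll'].
  by case: asboolP => // l'x; case: ll'; apply: uniq_inc l'x lx.
rewrite exchange_big /= big_seq.
rewrite (eq_bigr (fun=> m)) => [|l]; last first.
  rewrite in_fset_set // inE => Sl; rewrite -ncard_setI_sum // -(card_inc _ Sl).
  (* Intersecting with [inc l] makes the existential condition in [X] automatic, with [l] itself as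
     witness. *)
  congr ncard; apply/seteqP; split=> x [] => [[Ax _] lx|Ax lx] //.
  by split=> //; split=> //; exists l.
by rewrite -big_seq big_const_seq count_predT iter_addn_0 mulnC.
Qed.

End Counting.

(** * Representatives of projective points under Frobenius *)

Definition nzvec_of (K : fieldType) N (v : 'rV[K]_N.+1)
    (v0 : v != 0) : nzvec K N :=
  exist (fun y => y != 0) v v0.

Section ProjectivePoints.
Variables (K : fieldType) (N : nat).
Implicit Types (x y : nzvec K N) (p : projsp K N).

Lemma proj_eqP x y : \pi_(projsp K N) x = \pi_(projsp K N) y <->
  exists2 c : K, c != 0 & val y = c *: val x.
Proof. by split=> [/eqmodP/asboolP|e]; last exact/eqmodP/asboolP. Qed.

(** Lets results about one Frobenius be applied to its iterates, with a power of [q] in place of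
    [q]. *)
Lemma iter_frob q k p : iter k (@frob K N q) p = frob (q ^ k) p.
Proof.
elim: k => [|k IHk] /=.
  elim/quotW: p => x; rewrite frob_pi /=; apply/proj_eqP.
  exists 1; rewrite ?oner_neq0 // scale1r.
  by apply/rowP => i; rewrite !mxE expr1.
rewrite {}IHk; elim/quotW: p => x.
rewrite (frob_pi (q ^ k)) !frob_pi; congr (\pi _).
by apply/val_inj/rowP => i; rewrite !mxE -exprM expnSr.
Qed.

(* Dividing by a nonzero coordinate turns invariance up to a scalar into
   invariance on the nose. *)
Lemma frob_fixed_rep q p : frob q p = p ->
  exists2 x, \pi_(projsp K N) x = p & frob_vec q x = x.
Proof.
elim/quotW: p => x; rewrite frob_pi => /esym/proj_eqP[c c0 /= e].
have [i xi0] : exists i, val x 0 i != 0.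
  apply/existsP; apply: contraT; rewrite negb_exists => /forallP H.
  case/negP: (valP x); apply/eqP/rowP => i; rewrite mxE; apply/eqP.
  by have := H i; rewrite negbK.
have y0 : (val x 0 i)^-1 *: val x != 0.
  by rewrite scaler_eq0 invr_eq0 negb_or xi0 (valP x).
exists (nzvec_of y0).
  by apply/proj_eqP; exists (val x 0 i) => //=; rewrite scalerA divff ?scale1r.
apply/val_inj/rowP => j /=; rewrite !mxE exprMn exprVn.
have ej k : val x 0 k ^+ q = c * val x 0 k.
  by have /rowP/(_ k) := e; rewrite !mxE.
by rewrite !ej invfM mulrACA mulVf // mul1r.
Qed.

End ProjectivePoints.

(** * Finiteness of fixed points, and Frobenius as a field endomorphism *)

Lemma finite_set_frob_fixed_vec (K : closedFieldType) N q : (1 < q)%N ->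
  finite_set [set v : 'rV[K]_N | map_mx (fun a => a ^+ q) v = v].
Proof.
move=> q1; have [s es] := closed_field_poly_normal ('X^q - 'X : {poly K}).
(* A fixed coordinate is a root of ['X^q - 'X], which is nonzero because [q > 1]; [s] lists its
   roots. *)
have ps x : x ^+ q = x -> x \in s.
  move=> xq; have : root ('X^q - 'X) x by rewrite rootE !hornerE xq subrr.
  rewrite es rootZ ?root_prod_XsubC // lead_coef_eq0 -size_poly_gt0.
  by rewrite size_polyDl size_polyXn // size_polyN size_polyX.
pose h (g : {ffun 'I_N -> seq_sub s}) : 'rV[K]_N := \row_i ssval (g i).
apply: (@sub_finite_set _ _ (h @` setT)); last exact/finite_image/finite_finset.
move=> v /rowP vq; have vs i : v 0 i \in s.
  by apply: ps; have := vq i; rewrite !mxE.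
by exists [ffun i => SeqSub (vs i)] => //; apply/rowP => i; rewrite mxE ffunE.
Qed.

Lemma finite_set_frob_fixed (K : closedFieldType) N q : (1 < q)%N ->
  finite_set [set p : projsp K N | frob q p = p].
Proof.
move=> q1.
(* A fixed point [p0] supplies the default value that [insubd] takes on the zero vector. *)
have [->|/set0P[p0 _]] := eqVneq [set p : projsp K N | frob q p = p] set0.
  exact: finite_set0.
pose h (v : 'rV[K]_N.+1) : projsp K N :=
  \pi_(projsp K N) (insubd (repr p0 : nzvec K N) v).
apply: (@sub_finite_set _ _ (h @` [set v | map_mx (fun a => a ^+ q) v = v])).
  move=> p /frob_fixed_rep[x <- xq]; exists (val x); last by rewrite /h valKd.
  by have := congr1 val xq.
exact/finite_image/finite_set_frob_fixed_vec.
Qed.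

(** The order of [F] is a power of its characteristic, which [iota] carries over to [K]; the
    required map is an iterate of the characteristic-power Frobenius. *)
Lemma frobenius_rmorphism (F : finFieldType) (K : fieldType)
    (iota : {rmorphism F -> K}) : exists sigma : {rmorphism K -> K},
  forall x, sigma x = x ^+ #|F|.
Proof.
have [p _ pF] := finPcharP F.
have pK : p \in [pchar K] by rewrite (fmorph_pchar iota).
have -> : #|F| = (p ^ logn p #|F|)%N by exact: (card_pprimeChar pF).
elim: (logn _ _) => [|k [sigma sigmaE]].
  by exists idfun => x; rewrite expr1.
exists (pFrobenius_aut pK \o sigma) => x /=.
by rewrite sigmaE pFrobenius_autE -exprM expnSr.
Qed.

Lemma rmorphism_exprX (K : fieldType) (q k : nat) (sigma : {rmorphism K -> K}) :
  (forall x, sigma x = x ^+ q) ->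
  exists tau : {rmorphism K -> K}, forall x, tau x = x ^+ (q ^ k).
Proof.
move=> sigmaE; elim: k => [|k [tau tauE]].
  by exists idfun => x; rewrite expr1.
by exists (sigma \o tau) => x /=; rewrite sigmaE tauE -exprM expnSr.
Qed.

(** * Lines of the plane and their equations *)

Section Lines.
Variable K : fieldType.

Definition zeros (a : 'rV[K]_3) : set (projsp K 2) := [set p | on_zeros a p].

(** Turns incidence into a matrix product, so that kernels and ranks apply. *)
Lemma zeros_piP (a : 'rV[K]_3) (x : nzvec K 2) :
  zeros a (\pi_(projsp K 2) x) <-> val x *m a^T = 0.
Proof.
have -> : (val x *m a^T = 0) <-> \sum_(i < 3) a 0 i * val x 0 i = 0.
  have e : (val x *m a^T) 0 0 = \sum_(i < 3) a 0 i * val x 0 i.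
    by rewrite mxE; apply: eq_bigr => i _; rewrite mxE mulrC.
  rewrite -e; split=> [->|e0]; first by rewrite mxE.
  by apply/matrixP => i j; rewrite !ord1 e0 mxE.
exact: on_zeros_pi.
Qed.

Lemma rank_col_mx_le1 n (a b : 'rV[K]_n) : a != 0 -> b != 0 ->
  (\rank (col_mx a b) <= 1)%N -> exists2 c : K, c != 0 & b = c *: a.
Proof.
move=> a0 b0; rewrite -addsmxE => rk.
have := mxrank_leqif_sup (addsmxSl a b); rewrite rank_rV a0 => -[rk1 e].
have : (a + b <= a)%MS by rewrite -e eqn_leq rk1.
rewrite addsmx_sub => /andP[_ /sub_rVP[c bc]]; exists c => //.
by apply: contraNneq b0 => c0; rewrite bc c0 scale0r.
Qed.

Lemma zerosZ c a : c != 0 -> zeros (c *: a) = zeros a.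
Proof.
move=> c0; apply/seteqP; split; elim/quotW => x /zeros_piP e; apply/zeros_piP.
  move/eqP: e; rewrite linearZ /= -scalemxAr scaler_eq0 (negPf c0) => /eqP//.
by rewrite linearZ /= -scalemxAr e scaler0.
Qed.

(** The matrix of the two points annihilates that of the two equations, so their ranks sum to at
    most 3. Distinct points have rank 2, which forces the equations to be proportional. *)
Lemma zeros_eq_of_two_points a b p p' : a != 0 -> b != 0 -> p <> p' ->
  zeros a p -> zeros a p' -> zeros b p -> zeros b p' -> zeros a = zeros b.
Proof.
elim/quotW: p => x; elim/quotW: p' => y a0 b0 xy.
move=> /zeros_piP xa /zeros_piP ya /zeros_piP xb /zeros_piP yb.
have e : col_mx (val x) (val y) *m (col_mx a b)^T = 0.
  by rewrite tr_col_mx mul_col_row xa ya xb yb block_mx0.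
have := mulmx0_rank_max e; rewrite mxrank_tr => rk.
have [|c c0 ->] := @rank_col_mx_le1 _ a b a0 b0; last by rewrite zerosZ.
rewrite leqNgt; apply/negP => rk2; apply: xy; apply/proj_eqP.
apply: rank_col_mx_le1; rewrite ?(valP x) ?(valP y) //.
rewrite leqNgt; apply/negP => rk1.
by have := leq_trans (leq_add rk1 rk2) rk.
Qed.

(** Every nonzero row of the kernel of [a^T] is a point of the line, so [b] vanishes on that kernel.
    As the kernel has rank 2, [a] and [b] span rank at most 1. *)
Lemma zeros_inj a b : a != 0 -> b != 0 -> zeros a = zeros b ->
  exists2 c : K, c != 0 & b = c *: a.
Proof.
move=> a0 b0 ab; apply: rank_col_mx_le1 => //.
have kb : kermx a^T *m b^T = 0.
  apply/row_matrixP => i; rewrite row_mul row0.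
  have [->|r0] := eqVneq (row i (kermx a^T)) 0; first by rewrite mul0mx.
  have : zeros a (\pi_(projsp K 2) (nzvec_of r0)).
    by apply/zeros_piP; rewrite /= -row_mul mulmx_ker row0.
  by rewrite ab => /zeros_piP.
have e : kermx a^T *m (col_mx a b)^T = 0.
  by rewrite tr_col_mx mul_mx_row mulmx_ker kb row_mx0.
by have := mulmx0_rank_max e; rewrite mxrank_ker !mxrank_tr rank_rV a0.
Qed.

End Lines.

(** * Frobenius on points and lines, and the points of a fixed line *)

Section Frobenius.
Variables (K : closedFieldType) (q : nat) (sigma : {rmorphism K -> K}).
Hypotheses (q_gt1 : (1 < q)%N) (sigmaE : forall x, sigma x = x ^+ q).

Lemma val_frob_vec N (x : nzvec K N) :
  val (frob_vec q x) = map_mx sigma (val x).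
Proof. by apply/rowP => i; rewrite !mxE sigmaE. Qed.

Lemma sigma_surj y : exists x, sigma x = y.
Proof.
have /closed_rootP[x] : size ('X^q - y%:P) != 1%N.
  by rewrite size_XnsubC ?(ltnW q_gt1) // eqSS -lt0n ltnW.
by rewrite rootE !hornerE subr_eq0 => /eqP xy; exists x; rewrite sigmaE.
Qed.

Lemma frob_inj N : injective (@frob K N q).
Proof.
elim/quotW=> x; elim/quotW=> y; rewrite !frob_pi => /proj_eqP[c c0].
(* Writing the factor [c] as [sigma d] lets [sigma] be cancelled on both sides. *)
rewrite !val_frob_vec; have [d dc] := sigma_surj c; rewrite -dc -map_mxZ.
move=> /map_mx_inj e; apply/proj_eqP; exists d => //.
by rewrite -(fmorph_eq0 sigma) dc.
Qed.

Lemma frob_surj N (p : projsp K N) : exists p', frob q p' = p.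
Proof.
elim/quotW: p => -[v v0]; have [g gE] := choice sigma_surj.
have e : map_mx sigma (map_mx g v) = v by apply/rowP => i; rewrite !mxE gE.
have w0 : map_mx g v != 0 by rewrite -(map_mx_eq0 sigma) e.
exists (\pi_(projsp K N) (nzvec_of w0)); rewrite frob_pi; congr (\pi _).
by apply/val_inj; rewrite val_frob_vec.
Qed.

Lemma zeros_frob a p : zeros (map_mx sigma a) (frob q p) <-> zeros a p.
Proof.
elim/quotW: p => x; rewrite frob_pi.
split=> /zeros_piP e; apply/zeros_piP; move: e.
  by rewrite val_frob_vec map_trmx -map_mxM => /eqP; rewrite map_mx_eq0 => /eqP.
by rewrite val_frob_vec map_trmx -map_mxM => ->; rewrite map_mx0.
Qed.

Lemma frob_zeros a : frob q @` zeros a = zeros (map_mx sigma a).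
Proof.
apply/seteqP; split=> [_ [p ap <-]|p]; first exact/zeros_frob.
by have [p' <-] := frob_surj p => /zeros_frob ap; exists p'.
Qed.

Lemma frob_is_line l : is_line l -> is_line (@frob K 2 q @` l).
Proof.
by move=> [a a0 ->]; exists (map_mx sigma a); rewrite ?map_mx_eq0 ?frob_zeros.
Qed.

Lemma frob_fixed_line l : is_line l -> frob q @` l = l ->
  exists a, [/\ a != 0, map_mx sigma a = a & l = zeros a].
Proof.
move=> [a a0 ->]; rewrite -/(zeros a) frob_zeros => e.
have [|c c0 ca] := zeros_inj a0 _ (esym e); first by rewrite map_mx_eq0.
(* The coefficient vector is viewed as a point of the dual plane; that point is fixed by Frobenius,
   so it has a representative fixed coordinatewise. *)
have [|y /proj_eqP[d d0 dy] yq] :=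
    @frob_fixed_rep K 2 q (\pi_(projsp K 2) (nzvec_of a0)).
  by rewrite frob_pi; apply/esym/proj_eqP; exists c; rewrite ?val_frob_vec.
exists (val y); rewrite (valP y) -val_frob_vec yq; split=> //.
by rewrite -[a]/(val (nzvec_of a0)) dy zerosZ.
Qed.

Lemma finite_set_frob_fixed_lines :
  finite_set [set l | is_line l /\ @frob K 2 q @` l = l].
Proof.
apply: (@sub_finite_set _ _
  (@zeros K @` [set a | map_mx (fun x => x ^+ q) a = a])).
  move=> l [ll lq]; have [a [_ aq ->]] := frob_fixed_line ll lq.
  exists a => //=; rewrite -[RHS]aq; apply/rowP => i; by rewrite !mxE sigmaE.
exact/finite_image/finite_set_frob_fixed_vec.
Qed.

(** Solving the equation for a coordinate [i] with nonzero coefficient leaves the other two free.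
    The resulting basis involves only ratios of coefficients of [a], which [sigma] fixes. *)
Lemma frob_fixed_kernel_basis (a : 'rV[K]_3) : a != 0 -> map_mx sigma a = a ->
  exists B : 'M[K]_(2, 3),
    [/\ map_mx sigma B = B, row_free B & (B :=: kermx a^T)%MS].
Proof.
move=> a0 aq; have [i ai0] : exists i, a 0 i != 0.
  apply/existsP; apply: contraT; rewrite negb_exists => /forallP H.
  case/negP: a0; apply/eqP/rowP => i; rewrite mxE; apply/eqP.
  by have := H i; rewrite negbK.
pose t k := a 0 (lift i k) / a 0 i.
have aqE j : sigma (a 0 j) = a 0 j by have /rowP/(_ j) := aq; rewrite mxE.
pose B : 'M[K]_(2, 3) :=
  \matrix_k (delta_mx 0 (lift i k) - t k *: delta_mx 0 i).
(* [C] forgets coordinate [i], which makes it a right inverse of [B]. *)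
pose C : 'M[K]_(3, 2) := \matrix_(j, k) (j == lift i k)%:R.
have freeB : row_free B.
  apply/row_freeP; exists C; apply/row_matrixP => k.
  rewrite row_mul rowK mulmxBl -scalemxAl -!rowE.
  apply/rowP => m; rewrite !mxE (inj_eq lift_inj) (negPf (neq_lift i m)).
  by rewrite mulr0 subr0.
have Ba : B *m a^T = 0.
  apply/row_matrixP => k; rewrite row_mul rowK mulmxBl -scalemxAl -!rowE.
  by apply/rowP => m; rewrite !ord1 !mxE /t divfK // subrr.
exists B; split=> //.
  apply/matrixP => k j; rewrite !mxE rmorphB rmorphM fmorph_div !aqE.
  by rewrite !rmorph_nat.
have /sub_kermxP sB := Ba.
apply/eqmxP; rewrite sB /=; have [_ <-] := mxrank_leqif_sup sB.
by rewrite mxrank_ker mxrank_tr rank_rV a0 (eqP freeB).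
Qed.

Lemma qpoints_period N n (p : projsp K N) : qpoints q n p <->
  (0 < n)%N /\ forall m, iter m (frob q) p = p <-> (n %| m)%N.
Proof. exact: orbit_has_cardP (@frob_inj N) p n. Qed.

Lemma qlines_period n (l : set (projsp K 2)) : qlines q n l <->
  is_line l /\ (0 < n)%N /\ forall m, iter m (frob q) @` l = l <-> (n %| m)%N.
Proof.
have -> : qlines q n l <-> is_line l /\
   orbit_has_card (fun m : set (projsp K 2) => @frob K 2 q @` m) l n by [].
rewrite (orbit_has_cardP (image_injective (@frob_inj 2))).
split=> -[ll [n0 H]]; split=> //; split=> // m.
  by rewrite -iter_image.
by rewrite iter_image.
Qed.

Lemma finite_set_qpoints N n : finite_set (@qpoints K q N n).
Proof.
case: n => [|n].
  by apply: (@sub_finite_set _ _ set0); [move=> p /qpoints_period[]|].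
apply: (@sub_finite_set _ _ [set p : projsp K N | frob (q ^ n.+1) p = p]).
  by move=> p /qpoints_period[_ H] /=; rewrite -iter_frob; apply/H.
apply: finite_set_frob_fixed.
by rewrite -(exp1n n.+1) ltn_exp2r.
Qed.

(** Multiplication by the fixed kernel basis [B] maps the projective line bijectively onto [l] and
    commutes with Frobenius, so it preserves exact periods. *)
Lemma ncard_qpoints_line n (l : set (projsp K 2)) :
  is_line l -> frob q @` l = l ->
  ncard (qpoints q n `&` l) = ncard (@qpoints K q 1 n).
Proof.
move=> ll lq; have [a [a0 aq ->]] := frob_fixed_line ll lq.
have [B [Bq freeB kerB]] := frob_fixed_kernel_basis a0 aq.
have xB0 (x : nzvec K 1) : val x *m B != 0.
  apply: contraNneq (valP x) => e; apply/eqP/(row_free_inj freeB).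
  by rewrite /= e mul0mx.
pose xB x : nzvec K 2 := nzvec_of (xB0 x).
pose phi (p : projsp K 1) : projsp K 2 := \pi_(projsp K 2) (xB (repr p)).
have phi_pi x : phi (\pi_(projsp K 1) x) = \pi_(projsp K 2) (xB x).
  rewrite /phi; case: piP => y /proj_eqP[c c0 e]; apply/esym/proj_eqP.
  by exists c; rewrite //= e scalemxAl.
have phi_inj : injective phi.
  elim/quotW=> x; elim/quotW=> y; rewrite !phi_pi => /proj_eqP[c c0 /= e].
  apply/proj_eqP; exists c => //; apply: (row_free_inj freeB).
  by rewrite /= e scalemxAl.
have phi_frob p : phi (frob q p) = frob q (phi p).
  elim/quotW: p => x; rewrite frob_pi !phi_pi frob_pi; congr (\pi _).
  by apply/val_inj; rewrite val_frob_vec /= map_mxM Bq -val_frob_vec.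
have phi_iter m p : iter m (frob q) (phi p) = phi (iter m (frob q) p).
  by elim: m => //= m ->; rewrite phi_frob.
have phi_fix m p : iter m (frob q) (phi p) = phi p <-> iter m (frob q) p = p.
  by rewrite phi_iter; split=> [e|->]; first exact: phi_inj.
have phi_qpoints p : qpoints q n (phi p) <-> qpoints q n p.
  split=> /qpoints_period[n0 H]; apply/qpoints_period; split=> // m.
    by rewrite -phi_fix.
  by rewrite phi_fix.
rewrite -(@ncard_image _ _ phi (qpoints q n)); last 2 first.
- exact: finite_set_qpoints.
- by move=> x y _ _; apply: phi_inj.
(* Surjectivity: a point of [l] lies in the kernel of [a^T], which is the row space of [B]. *)
congr ncard; apply/seteqP; split=> [p|_ [p pn <-]].
  move=> [pn]; elim/quotW: p pn => y yn /zeros_piP/sub_kermxP.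
  rewrite -kerB => /submxP[w wy].
  have w0 : w != 0.
    by apply: contraNneq (valP y) => e; rewrite wy e mul0mx.
  have e : phi (\pi_(projsp K 1) (nzvec_of w0)) = \pi_(projsp K 2) y.
    by rewrite phi_pi; congr (\pi _); apply/val_inj; rewrite /= wy.
  exists (\pi_(projsp K 1) (nzvec_of w0)) => //.
  by apply/phi_qpoints; rewrite e.
split; first exact/phi_qpoints.
elim/quotW: p pn => x _; rewrite phi_pi; apply/zeros_piP/sub_kermxP.
by rewrite -kerB submxMl.
Qed.

End Frobenius.

(** * Points of given period on lines of given period *)

Section PointsOnLines.
Variables (K : closedFieldType) (q : nat) (sigma : {rmorphism K -> K}).
Hypotheses (q_gt1 : (1 < q)%N) (sigmaE : forall x, sigma x = x ^+ q).

Let qpointsP := qpoints_period q_gt1 sigmaE.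
Let qlinesP := qlines_period q_gt1 sigmaE.

Lemma finite_set_qlines r : finite_set (@qlines K q r).
Proof.
case: r => [|r].
  by apply: (@sub_finite_set _ _ set0); [move=> l /qlinesP[_ []]|].
have [tau tauE] := rmorphism_exprX r.+1 sigmaE.
have qr1 : (1 < q ^ r.+1)%N by rewrite -(exp1n r.+1) ltn_exp2r.
apply: (sub_finite_set _ (finite_set_frob_fixed_lines qr1 tauE)).
move=> l /qlinesP[ll [_ H]]; split=> //.
have -> : @frob K 2 (q ^ r.+1) = iter r.+1 (frob q).
  by apply/funext => p; rewrite iter_frob.
exact/H.
Qed.

Lemma line_eq_of_two_points (l l' : set (projsp K 2)) p p' :
  is_line l -> is_line l' -> p <> p' -> l p -> l p' -> l' p -> l' p' -> l = l'.
Proof. by move=> [a a0 ->] [b b0 ->]; apply: zeros_eq_of_two_points. Qed.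

(** Both lines contain [p] and its [r]-th Frobenius iterate, which differ because [n] does not
    divide [r]. *)
Lemma line_uniq_of_period n r p (l l' : set (projsp K 2)) :
    qpoints q n p -> ~~ (n %| r)%N -> is_line l -> is_line l' ->
    iter r (frob q) @` l = l -> iter r (frob q) @` l' = l' ->
  l p -> l' p -> l = l'.
Proof.
move=> /qpointsP[_ per] nr ll ll' lr lr' lp lp'.
apply: (@line_eq_of_two_points l l' p (iter r (frob q) p)) => //.
- by move=> /esym/per; apply/negP.
- by rewrite -lr; exists p.
- by rewrite -lr'; exists p.
Qed.

(* By the Chinese remainder theorem l contains the whole orbit of p, and hence
   so does its image under Frobenius. *)
Lemma qline_coprime n r p (l : set (projsp K 2)) : (1 < n)%N -> coprime r n ->
  qpoints q n p -> qlines q r l -> l p -> r = 1%N.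
Proof.
move=> n1 rn pn /qlinesP[ll [r0 lper]] lp.
have /qpointsP[n0 pper] := pn.
have pn_fix : iter n (frob q) p = p by apply/pper.
have orb t : l (iter t (frob q) p).
  (* This exponent is 0 modulo [r], so it preserves [l], and [t] modulo [n], so it sends [p] where
     [t] does. *)
  have e : iter (chinese r n 0 t) (frob q) @` l = l.
    by apply/lper; rewrite /dvdn chinese_modl ?mod0n.
  rewrite (iter_fix_mod t pn_fix) -(chinese_modr rn 0 t).
  by rewrite -(iter_fix_mod _ pn_fix) -e; exists p.
have e : frob q @` l = l.
  apply: (@line_eq_of_two_points _ _ p (frob q p)) => //.
  - exact: frob_is_line q_gt1 sigmaE _ _.
  - move=> /esym e; have /(pper 1%N) : iter 1 (frob q) p = p by [].
    by rewrite dvdn1 => /eqP n1'; rewrite n1' in n1.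
  - by exists (iter n.-1 (frob q) p); rewrite // -iterS prednK.
  - exact: orb 1%N.
by apply/eqP; rewrite -dvdn1; apply/lper.
Qed.

Definition qpoints_on_qlines n r : set (projsp K 2) :=
  [set p | qpoints q n p /\ exists2 l, qlines q r l & l p].

Lemma finite_set_qpoints_on_qlines n r : finite_set (qpoints_on_qlines n r).
Proof.
by apply: (sub_finite_set _ (finite_set_qpoints q_gt1 sigmaE 2 n)) => p [].
Qed.

Lemma ncard_qpoints_on_qlines n r m : ~~ (n %| r)%N ->
  (forall l : set (projsp K 2), qlines q r l ->
    ncard (qpoints q n `&` l) = m) ->
  ncard (qpoints_on_qlines n r) = (ncard (@qlines K q r) * m)%N.
Proof.
move=> nr cardl; apply: (@ncard_double_count _ _ _ _ (fun l => l)) => //.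
- exact: finite_set_qpoints q_gt1 sigmaE _ _.
- exact: finite_set_qlines.
move=> p l l' pn /qlinesP[ll [_ lr]] /qlinesP[ll' [_ lr']].
by apply: (line_uniq_of_period pn nr) => //; [apply/lr|apply/lr'].
Qed.

Lemma ncard_qpoints_on_qlines1 n : (1 < n)%N ->
  ncard (qpoints_on_qlines n 1)
  = (ncard (@qlines K q 1) * ncard (@qpoints K q 1 n))%N.
Proof.
move=> n1; apply: ncard_qpoints_on_qlines.
  by rewrite dvdn1 gtn_eqF.
move=> l /qlinesP[ll [_ lper]]; apply: (ncard_qpoints_line q_gt1 sigmaE) => //.
exact: (lper 1%N).2.
Qed.

(* A point of Frobenius period 3 never lies on a line of period 2, so on such
   a line period 3 under the squared Frobenius forces period 6. *)
Lemma qpoints6_qline2 (l : set (projsp K 2)) : qlines q 2 l ->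
  qpoints q 6 `&` l = qpoints (q ^ 2) 3 `&` l.
Proof.
move=> ll.
have [tau tauE] := rmorphism_exprX 2 sigmaE.
have q21 : (1 < q ^ 2)%N by rewrite -(exp1n 2) ltn_exp2r.
have iter2 m (p : projsp K 2) :
    iter m (frob (q ^ 2)) p = iter (m * 2) (frob q) p.
  by rewrite !iter_frob -expnM mulnC.
have per2 (p : projsp K 2) : qpoints (q ^ 2) 3 p <->
    forall m, iter (m * 2) (frob q) p = p <-> (3 %| m)%N.
  rewrite (qpoints_period q21 tauE); split=> [[_ H]|H]; last split=> //.
    by move=> m; rewrite -iter2.
  by move=> m; rewrite iter2.
apply/seteqP; split=> p [pn lp]; split=> //.
  apply/per2 => m; have /qpointsP[_ ->] := pn.
  by rewrite -[6%N]/(3 * 2)%N dvdn_pmul2r.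
have /per2 H := pn.
have p6 : iter 6 (frob q) p = p by apply/(H 3).
have p2 : iter 2 (frob q) p <> p by move/(H 1%N).
apply/qpointsP; split=> // m; split=> [pm|/dvdnP[c ->]]; last exact: iter_fixM.
have m3 : (3 %| m)%N by apply/H; rewrite mulnC; apply: iter_fixM.
(* Only the parity of [m] is left. An odd multiple of 3 is 3 modulo 6, so [p] would be fixed by the
   third iterate. *)
have [odd_m|/negPf even_m] := boolP (odd m); last first.
  by rewrite -[6%N]/(2 * 3)%N Gauss_dvd // dvdn2 even_m m3.
have p3 : iter 3 (frob q) p = p.
  have e : (m %% 6 = 3)%N.
    have : (m %% 6 < 6)%N by rewrite ltn_mod.
    have : (3 %| m %% 6)%N by rewrite /dvdn modn_dvdm.
    have : odd (m %% 6)
      by rewrite -[odd _]negbK -dvdn2 /dvdn modn_dvdm ?modn2 ?odd_m.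
    by case: (m %% 6)%N => [|[|[|[|[|[|]]]]]].
  by rewrite -e -iter_fix_mod.
(* Since 2 and 3 are coprime, exact period 3 would force the line to have period 1 instead of 2. *)
suff : qpoints q 3 p by move=> /qline_coprime/(_ ll lp); move/(_ isT isT).
apply/qpointsP; split=> // k; split=> [pk|/dvdnP[c ->]]; last exact: iter_fixM.
by apply/H; rewrite mulnC; apply: iter_fixM.
Qed.

Lemma ncard_qpoints_on_qlines2 :
  ncard (qpoints_on_qlines 6 2)
  = (ncard (@qlines K q 2) * ncard (@qpoints K (q ^ 2) 1 3))%N.
Proof.
apply: ncard_qpoints_on_qlines => // l lq; rewrite qpoints6_qline2 //.
have [tau tauE] := rmorphism_exprX 2 sigmaE.
have q21 : (1 < q ^ 2)%N by rewrite -(exp1n 2) ltn_exp2r.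
have /qlinesP[ll [_ lper]] := lq.
apply: (ncard_qpoints_line q21 tauE) => //.
have -> : @frob K 2 (q ^ 2) = iter 2 (frob q).
  by apply/funext => p; rewrite iter_frob.
exact/lper.
Qed.

Lemma qpoints_generic_split n : (3 <= n < 6)%N ->
  qpoints q n = generic_qpoints q n `|` qpoints_on_qlines n 1.
Proof.
move=> n36; apply/seteqP; split=> [p pn|p [[]|[]]//].
have [on1|off1] := pselect (exists2 l, qlines q 1 l & l p); [by right|left].
split=> // r l rn lr lp; apply: off1; exists l => //.
have /qlinesP[_ [r0 _]] := lr.
suff <- : r = 1%N by [].
(* For [n = 4] the bound [n./2] leaves only [r = 1]. For the primes 3 and 5 every positive [r < n]
   is coprime to [n]. *)
have [e4|n4] := eqVneq n 4.
  by move: rn r0; rewrite e4; case: r {lr} => [|[|]].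
apply: (qline_coprime _ _ pn lr lp).
  by case: n n36 {pn rn n4} => [|[|]].
move: n n36 n4 r rn r0 {pn lr lp} => [|[|[|[|[|[|]]]]]] // _ _.
  by case=> [|[|[|]]].
by case=> [|[|[|[|[|]]]]].
Qed.

Lemma qpoints6_generic_split :
  qpoints q 6 = generic_qpoints q 6
    `|` (qpoints_on_qlines 6 1 `|` qpoints_on_qlines 6 2).
Proof.
apply/seteqP; split=> [p pn|p [[]|[[]|[]]]//].
have [on1|off1] := pselect (exists2 l, qlines q 1 l & l p).
  by right; left.
have [on2|off2] := pselect (exists2 l, qlines q 2 l & l p).
  by right; right.
(* The bound [6./2 = 3] leaves [r] equal to 0, 1 or 2, and 0 is impossible because an orbit is
   nonempty. *)
left; split=> // -[|[|[|]]] l //= _ lr lp.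
- by have /qlinesP[_ []] := lr.
- by apply: off1; exists l.
- by apply: off2; exists l.
Qed.

Lemma finite_set_generic_qpoints n : finite_set (@generic_qpoints K q n).
Proof.
by apply: (sub_finite_set _ (finite_set_qpoints q_gt1 sigmaE 2 n)) => p [].
Qed.

Lemma generic_qpoints_off_qlines n r : (r < if odd n then n else n./2)%N ->
  generic_qpoints q n `&` qpoints_on_qlines n r = set0.
Proof.
move=> rn; rewrite -subset0 => p [[_ gen] [_ [l lr lp]]].
exact: gen rn lr lp.
Qed.

(** A line fixed by Frobenius is also fixed by its square, so uniqueness for [r = 2] would identify
    the two lines, although their periods differ. *)
Lemma qpoints_on_qlines12_disjoint :
  qpoints_on_qlines 6 1 `&` qpoints_on_qlines 6 2 = set0.
Proof.
rewrite -subset0 => p [[pn [l l1 lp]] [_ [l' l2 lp']]].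
have /qlinesP[ll [_ lper]] := l1.
have /qlinesP[ll' [_ lper']] := l2.
have e : l = l'.
  by apply: (@line_uniq_of_period 6 2 p) => //; [apply/lper|apply/lper'].
by have /lper' : iter 1 (frob q) @` l' = l' by rewrite -e; apply/lper.
Qed.

End PointsOnLines.

Theorem proposition4p7 (F : finFieldType) (K : closedFieldType)
    (iota : {rmorphism F -> K}) (algK : forall x : K, algebraicOver iota x)
    (q : nat) (cardF : #|F| = q) :
  (forall n : nat, (3 <= n < 6)%N ->
     (ncard (@generic_qpoints K q n))%:Z
     = (ncard (@qpoints K q 2 n))%:Z
       - (ncard (@qlines K q 1))%:Z * (ncard (@qpoints K q 1 n))%:Z)
  /\
  (ncard (@generic_qpoints K q 6))%:Z
  = (ncard (@qpoints K q 2 6))%:Z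
    - (ncard (@qlines K q 1))%:Z * (ncard (@qpoints K q 1 6))%:Z
    - (ncard (@qlines K q 2))%:Z * (ncard (@qpoints K (q ^ 2) 1 3))%:Z.
Proof.
(* The finite field provides both the [q]-power map as an endomorphism of [K] and the bound
   [1 < q]. *)
have [sigma] := frobenius_rmorphism iota; rewrite cardF => sigmaE.
have q1 : (1 < q)%N by rewrite -cardF finNzRing_gt1.
have finG n := finite_set_generic_qpoints q1 sigmaE n.
have finL n r := finite_set_qpoints_on_qlines q1 sigmaE n r.
split=> [n n36|].
  have n1 : (1 < n)%N by case: n n36 => [|[|]].
  rewrite (qpoints_generic_split q1 sigmaE n36) ncardU //; last first.
    apply: generic_qpoints_off_qlines.
    by case: n n36 {n1} => [|[|[|[|[|[|]]]]]].
  by rewrite (ncard_qpoints_on_qlines1 q1 sigmaE n1) PoszD PoszM addrK.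
rewrite (qpoints6_generic_split q1 sigmaE) !ncardU ?finite_setU //;
  last 2 first.
- exact: qpoints_on_qlines12_disjoint q1 sigmaE.
- by rewrite setIUr !generic_qpoints_off_qlines // setU0.
rewrite (ncard_qpoints_on_qlines1 q1 sigmaE) //.
rewrite (ncard_qpoints_on_qlines2 q1 sigmaE).
by rewrite !PoszD !PoszM -addrA -opprD addrK.
Qed.
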